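(* Let $(X,d)$ be a compact metric space and let $T_1,\dots,T_k\colon X\to X$ ($k\ge2$) be continuous maps such that the set $S_{\mathrm t}$ of weakly hyperbolic sequences of $\mathrm{IFS}(T_1,\dots,T_k)$ is non-empty. Then there exists at most one strict attractor of the IFS. If such a strict attractor exists, then it is equal to $\overline{A_{\mathrm t}}$, where $A_{\mathrm t}$ is the target set.
   Context: The Barnsley-Hutchinson operator of $\mathrm{IFS}(T_1,\dots,T_k)$ is $\mathcal B(A)=\bigcup_{i=1}^k T_i(A)$ for $A\subset X$. $\mathcal H(X)$ is the set of non-empty compact subsets of $X$ with the Hausdorff distance; limits of compact sets are taken in this distance. $\Sigma_k^+=\{1,\dots,k\}^{\mathbb N}$. The set of weakly hyperbolic sequences is $S_{\mathrm t}=\{\xi\in\Sigma_k^+ : \lim_{n\to\infty}\mathrm{diam}(T_{\xi_0}\circ\cdots\circ T_{\xi_n}(X))=0\}$. The coding map $\pi\colon S_{\mathrm t}\to X$ is $\pi(\xi)=\lim_{n\to\infty}T_{\xi_0}\circ\cdots\circ T_{\xi_n}(p)$, which does not depend on $p\in X$. The target set is $A_{\mathrm t}=\pi(S_{\mathrm t})$. A compact set $A\in\mathcal H(X)$ is a strict attractor if there is an open neighbourhood $U$ of $A$ such that $\lim_{n\to\infty}\mathcal B^n(K)=A$ for every non-empty compact set $K\subset U$. *)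

(* Defs.v *)
From HB Require Import structures.
From mathcomp Require Import all_boot all_order all_algebra.
From mathcomp Require Import all_classical all_reals all_analysis.

Set Implicit Arguments.
Unset Strict Implicit.
Unset Printing Implicit Defensive.

Import Order.TTheory GRing.Theory Num.Theory.
Import numFieldNormedType.Exports.

Local Open Scope classical_set_scope.
Local Open Scope ring_scope.

(* The real-valued [sup] and [inf] below are junk (0) on empty or unbounded
   sets; this is harmless for non-empty subsets of a compact space. *)
Definition diam (R : realType) (X : metricType R) (A : set X) : R :=
  sup [set mdist p.1 p.2 | p in A `*` A].

Definition dist_to_set (R : realType) (X : metricType R) (x : X) (A : set X)
    : R :=
  inf [set mdist x a | a in A].

Definition hausdorff_dist (R : realType) (X : metricType R) (A B : set X) : R :=
  Num.max (sup [set dist_to_set a B | a in A])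
          (sup [set dist_to_set b A | b in B]).

Definition barnsley_hutchinson (X : Type) (k : nat) (T : 'I_k -> X -> X)
    (A : set X) : set X :=
  \bigcup_(i in [set: 'I_k]) (T i @` A).

(* T_{xi 0} \o ... \o T_{xi n}: n + 1 maps, the newest one applied first. *)
Fixpoint comp_seq (X : Type) (k : nat) (T : 'I_k -> X -> X)
    (xi : nat -> 'I_k) (n : nat) : X -> X :=
  if n is m.+1 then comp_seq T xi m \o T (xi n) else T (xi 0%N).

Definition weakly_hyperbolic (R : realType) (X : metricType R) (k : nat)
    (T : 'I_k -> X -> X) : set (nat -> 'I_k) :=
  [set xi | diam (comp_seq T xi n @` [set: X]) @[n --> \oo] --> (0 : R)].

(* The graph of the coding map: [is_coding T xi x] means pi(xi) = x.
   A relation is used because [X] has no distinguished point to serve as the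
   base point p or as a default value; [coding_unique] shows that, on weakly
   hyperbolic sequences, it is the graph of a function. *)
Definition is_coding (R : realType) (X : metricType R) (k : nat)
    (T : 'I_k -> X -> X) (xi : nat -> 'I_k) (x : X) : Prop :=
  forall p : X, comp_seq T xi n p @[n --> \oo] --> x.

Definition target_set (R : realType) (X : metricType R) (k : nat)
    (T : 'I_k -> X -> X) : set X :=
  [set x | exists2 xi, weakly_hyperbolic T xi & is_coding T xi x].

Definition strict_attractor (R : realType) (X : metricType R) (k : nat)
    (T : 'I_k -> X -> X) (A : set X) : Prop :=
  [/\ A !=set0, compact A &
      exists U : set X, [/\ open U, A `<=` U &
        forall K : set X, K !=set0 -> compact K -> K `<=` U ->
          hausdorff_dist (iter n (barnsley_hutchinson T) K) A @[n --> \oo]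
            --> (0 : R)]].

Lemma comp_seq_nested (X : Type) (k : nat) (T : 'I_k -> X -> X)
    (xi : nat -> 'I_k) (n m : nat) : (n <= m)%N ->
  comp_seq T xi m @` [set: X] `<=` comp_seq T xi n @` [set: X].
Proof.
elim: m => [|m IH]; first by rewrite leqn0 => /eqP->.
rewrite leq_eqVlt => /orP[/eqP-> //|]; rewrite ltnS => /IH nm y /= [p _ <-].
by apply: nm; exists (T (xi m.+1) p).
Qed.

Lemma mdist_le_diam (R : realType) (X : metricType R) (A : set X) (x y : X) :
  compact [set: X] -> A x -> A y -> mdist x y <= diam A.
Proof.
move=> cX Ax Ay; apply: ub_le_sup; last by exists (x, y).
have /compact_near_coveringP cov := cX.
have : \forall M \near +oo%R, [set: X] `<=` (fun z => mdist x z < M).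
  apply: cov => z _.
  exists (ball z 1, [set M | mdist x z + 1 < M]).
    by split; [exact: nbhsx_ballx|apply: nbhs_pinfty_gt; rewrite num_real].
  move=> [u M] [/=]; rewrite ballEmdist /= => zu; apply: le_lt_trans.
  by rewrite (le_trans (metric_triangle x z u))// lerD2l ltW.
move=> [M [_ HM]].
have {}HM z : mdist x z <= M + 1.
  by apply: ltW; apply: (HM (M + 1)) => //; rewrite ltrDl.
exists ((M + 1) + (M + 1)) => _ [[a b] _ <-] /=.
apply: (le_trans (metric_triangle a x b)).
by rewrite lerD// metric_sym.
Qed.

Lemma coding_unique (R : realType) (X : metricType R) (k : nat)
    (T : 'I_k -> X -> X) (xi : nat -> 'I_k) :
  compact [set: X] -> [set: X] !=set0 -> weakly_hyperbolic T xi ->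
  exists! x, is_coding T xi x.
Proof.
move=> cX [p _] wh.
have [x [_ clx]] := cX (comp_seq T xi n p @[n --> \oo]) _ filterT.
have cod : is_coding T xi x.
  move=> q; apply/metricType_numDomainType.cvgrPdist_lt => e e0.
  have e20 : 0 < e / 2 by rewrite divr_gt0.
  have /cvgrPdist_lt/(_ _ e20)[N _ HN] := wh.
  have /= := HN N (leqnn N); rewrite sub0r normrN => dN.
  exists N => // m /= Nm.
  have [|y [[j /= _ jy] xy]] :=
      clx (comp_seq T xi N @` [set: X]) (ball x (e / 2)) _ (nbhsx_ballx _ _ e20).
    by exists N => // j /= Nj; apply: (comp_seq_nested Nj); exists p.
  move: xy; rewrite ballEmdist /= => xy.
  apply: (le_lt_trans (metric_triangle _ y _)).
  rewrite [e]splitr ltrD//; apply: le_lt_trans dN.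
  apply: le_trans (ler_norm _); apply: mdist_le_diam => //.
    by exists j.
  by apply: (comp_seq_nested Nm); exists q.
exists x; split=> // y cody.
exact: (cvg_unique (@metric_hausdorff R X) (cod p) (cody p)).
Qed.

(* Main.v *)
Require Import Defs.
From HB Require Import structures.
From mathcomp Require Import all_boot all_order all_algebra.
From mathcomp Require Import all_classical all_reals all_analysis.

Set Implicit Arguments.
Unset Strict Implicit.
Unset Printing Implicit Defensive.

Import Order.TTheory GRing.Theory Num.Theory.
Import numFieldNormedType.Exports.

Local Open Scope classical_set_scope.
Local Open Scope ring_scope.

(** Only orbits of single points are needed to identify a strict attractor [A].

    Orbits of a point [p] of [A]: for a weakly hyperbolic [xi], the points
    [T_{xi 0} \o ... \o T_{xi n} p] lie in the iterates of [[set p]] under the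
    Barnsley-Hutchinson operator ([comp_seq_in_iter]). They converge to
    [pi(xi)], and their distance to [A] tends to 0; as [A] is closed, it
    contains the target set and its closure ([target_set_sub_attractor]).

    Orbits of a point [z] of the target set: prefixing a weakly hyperbolic
    sequence [xi] with a symbol [i] gives a weakly hyperbolic sequence whose
    code is [T_i (pi(xi))], so the target set is forward invariant
    ([target_set_forward_invariant]) and contains all the iterates of
    [[set z]]. By the first inclusion [z] lies in [A], hence these iterates
    converge to [A], and every point of [A] is a limit of points of the target
    set ([attractor_sub_closure_target_set]).

    Thus every strict attractor is the closure of the target set, which gives
    uniqueness as well. *)

Lemma hausdorff_distC (R : realType) (X : metricType R) (A B : set X) :
  hausdorff_dist A B = hausdorff_dist B A.
Proof. by rewrite /hausdorff_dist maxC. Qed.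

Lemma dist_to_set_le_mdist (R : realType) (X : metricType R) (A : set X)
    (x a : X) : A a -> dist_to_set x A <= mdist x a.
Proof.
move=> Aa; apply: ge_inf; last by exists a.
by exists 0 => _ [b _ <-]; exact: mdist_ge0.
Qed.

(** Compactness of [X] bounds the distances to [B]; without a bound the
    supremum in the Hausdorff distance would take its default value. *)
Lemma hausdorff_dist_lt_near (R : realType) (X : metricType R) (A B : set X)
    (e : R) (a : X) : compact [set: X] -> B !=set0 -> A a ->
  hausdorff_dist A B < e -> exists2 b, B b & mdist a b < e.
Proof.
move=> cX [b0 Bb0] Aa; rewrite /hausdorff_dist gt_max => /andP[supe _].
have : dist_to_set a B < e.
  apply: le_lt_trans supe; apply: ub_le_sup; last by exists a.
  exists (diam [set: X]) => _ [c _ <-].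
  apply: (le_trans (dist_to_set_le_mdist c Bb0)).
  exact: mdist_le_diam.
move=> infe.
have [|_ [b Bb <-] ab] := inf_lt _ infe; last by exists b.
by exists (mdist a b0), b0.
Qed.

Lemma diam_ge0 (R : realType) (X : metricType R) (A : set X) :
  compact [set: X] -> A !=set0 -> 0 <= diam A.
Proof.
by move=> cX [a Aa]; rewrite -(mdistxx a); exact: mdist_le_diam.
Qed.

Lemma diam_le (R : realType) (X : metricType R) (A : set X) (r : R) :
  A !=set0 -> (forall x y, A x -> A y -> mdist x y <= r) -> diam A <= r.
Proof.
move=> [a Aa] Ar; apply: ge_sup; first by exists (mdist a a), (a, a).
by move=> _ [[x y] [/= Ax Ay] <-]; exact: Ar.
Qed.

Definition cons_seq (k : nat) (i : 'I_k) (xi : nat -> 'I_k) : nat -> 'I_k :=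
  fun n => if n is m.+1 then xi m else i.

Lemma comp_seq_cons (X : Type) (k : nat) (T : 'I_k -> X -> X) (i : 'I_k)
    (xi : nat -> 'I_k) (n : nat) (p : X) :
  comp_seq T (cons_seq i xi) n.+1 p = T i (comp_seq T xi n p).
Proof. by elim: n p => //= n IH p; rewrite -IH. Qed.

Lemma comp_seq_in_iter (X : Type) (k : nat) (T : 'I_k -> X -> X)
    (xi : nat -> 'I_k) (n : nat) (K : set X) (p : X) :
  K p -> iter n.+1 (barnsley_hutchinson T) K (comp_seq T xi n p).
Proof.
elim: n K p => [|n IH] K p Kp; first by exists (xi 0%N) => //; exists p.
by rewrite iterSr; apply: IH; exists (xi n.+1) => //; exists p.
Qed.

(** The convergence defining the coding map is uniform in the base point. This
    is what lets continuity of [T i] at the single point [x] control the diameter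
    of the images of the whole space in the next lemma. *)
Lemma coding_uniform (R : realType) (X : metricType R) (k : nat)
    (T : 'I_k -> X -> X) (xi : nat -> 'I_k) (x : X) (e : R) :
  compact [set: X] -> weakly_hyperbolic T xi -> is_coding T xi x -> 0 < e ->
  \forall n \near \oo, forall p, mdist x (comp_seq T xi n p) < e.
Proof.
move=> cX wh cod e0; have e20 : 0 < e / 2 by rewrite divr_gt0.
have /cvgrPdist_lt/(_ _ e20) dn := wh.
have /metricType_numDomainType.cvgrPdist_lt/(_ _ e20) xn := cod x.
near=> n => p.
apply: (le_lt_trans (metric_triangle _ (comp_seq T xi n x) _)).
rewrite [e]splitr ltrD//; first by near: n.
apply: (@le_lt_trans _ _ (diam (comp_seq T xi n @` [set: X]))).
  exact: mdist_le_diam.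
apply: le_lt_trans (ler_norm _) _; rewrite -normrN -sub0r.
by near: n.
Unshelve. all: by end_near. Qed.

Lemma cons_seq_coding (R : realType) (X : metricType R) (k : nat)
    (T : 'I_k -> X -> X) (i : 'I_k) (xi : nat -> 'I_k) (x : X) :
  compact [set: X] -> continuous (T i) ->
  weakly_hyperbolic T xi -> is_coding T xi x ->
  weakly_hyperbolic T (cons_seq i xi) /\ is_coding T (cons_seq i xi) (T i x).
Proof.
move=> cX Ti wh cod.
have unif e : 0 < e -> \forall n \near \oo,
    forall p, mdist (T i x) (T i (comp_seq T xi n p)) < e.
  move=> e0.
  have : nbhs x (T i @^-1` ball (T i x) e) by apply: Ti; exact: nbhsx_ballx.
  move=> /nbhs_ballP[d /= d0 xd].
  have := coding_uniform cX wh cod d0.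
  apply: filterS => n xn p.
  have /= := xd (comp_seq T xi n p).
  by rewrite !ballEmdist /=; apply; exact: xn.
split.
  rewrite /weakly_hyperbolic /= -(cvg_shiftS _).
  apply/cvgrPdist_le => e e0; have e20 : 0 < e / 2 by rewrite divr_gt0.
  near=> n.
  have xn p : mdist (T i x) (T i (comp_seq T xi n p)) < e / 2.
    by move: p; near: n; exact: unif.
  have im0 : comp_seq T (cons_seq i xi) n.+1 @` [set: X] !=set0.
    by exists (comp_seq T (cons_seq i xi) n.+1 x), x.
  rewrite sub0r normrN ger0_norm; last exact: diam_ge0.
  apply: diam_le => // _ _ [p _ <-] [q _ <-]; rewrite !comp_seq_cons.
  apply: (le_trans (metric_triangle _ (T i x) _)).
  by rewrite (metric_sym _ (T i x)) [e]splitr lerD// ltW.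
move=> p; apply/metricType_numDomainType.cvgrPdist_lt => e e0.
apply: near_inftyS; near=> n.
by rewrite comp_seq_cons; move: p; near: n; exact: unif.
Unshelve. all: by end_near. Qed.

Lemma target_set_forward_invariant (R : realType) (X : metricType R) (k : nat)
    (T : 'I_k -> X -> X) :
  compact [set: X] -> (forall i, continuous (T i)) ->
  barnsley_hutchinson T (target_set T) `<=` target_set T.
Proof.
move=> cX Tc _ [i _ [x [xi wh cod] <-]].
have [wh' cod'] := cons_seq_coding cX (Tc i) wh cod.
by exists (cons_seq i xi).
Qed.

Lemma iter_barnsley_hutchinson_sub (X : Type) (k : nat) (T : 'I_k -> X -> X)
    (K D : set X) (n : nat) :
  barnsley_hutchinson T D `<=` D -> K `<=` D ->
  iter n (barnsley_hutchinson T) K `<=` D.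
Proof.
move=> TD KD; elim: n => //= n IH _ [i _ [x xn <-]].
by apply: TD; exists i => //; exists x => //; exact: IH.
Qed.

Lemma strict_attractor_cvg1 (R : realType) (X : metricType R) (k : nat)
    (T : 'I_k -> X -> X) (A : set X) (p : X) :
  strict_attractor T A -> A p ->
  hausdorff_dist (iter n (barnsley_hutchinson T) [set p]) A @[n --> \oo]
    --> (0 : R).
Proof.
move=> [_ _ [U [_ AU UA]]] Ap; apply: UA; first by exists p.
  exact: compact_set1.
by move=> _ ->; exact: AU.
Qed.

Lemma closure_mdist (R : realType) (X : metricType R) (A : set X) (x : X) :
  (forall e, 0 < e -> exists2 a, A a & mdist x a < e) -> closure A x.
Proof.
move=> Ax V /nbhs_ballP[e /= e0 eV]; have [a Aa xa] := Ax _ e0.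
by exists a; split => //; apply: eV; rewrite ballEmdist.
Qed.

Lemma target_set_sub_attractor (R : realType) (X : metricType R) (k : nat)
    (T : 'I_k -> X -> X) (A : set X) :
  compact [set: X] -> strict_attractor T A -> target_set T `<=` A.
Proof.
move=> cX sA x [xi wh cod]; have [[p Ap] cA _] := sA.
have /closure_id -> : closed A.
  by apply: compact_closed => //; exact: metric_hausdorff.
apply: closure_mdist => e e0; have e20 : 0 < e / 2 by rewrite divr_gt0.
have /metricType_numDomainType.cvgrPdist_lt/(_ _ e20) xn := cod p.
have := strict_attractor_cvg1 sA Ap; rewrite -(cvg_shiftS _).
move=> /cvgrPdist_lt/(_ _ e20) An.
have [n []] := filter_ex (filterI xn An).
rewrite sub0r normrN => xpn /(le_lt_trans (ler_norm _)) hn.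
have [|a Aa ya] := hausdorff_dist_lt_near cX _ (comp_seq_in_iter T xi n erefl) hn.
  by exists p.
exists a => //; apply: (le_lt_trans (metric_triangle _ (comp_seq T xi n p) _)).
by rewrite [e]splitr ltrD.
Qed.

Lemma attractor_sub_closure_target_set (R : realType) (X : metricType R)
    (k : nat) (T : 'I_k -> X -> X) (A : set X) :
  compact [set: X] -> (forall i, continuous (T i)) ->
  weakly_hyperbolic T !=set0 ->
  strict_attractor T A -> A `<=` closure (target_set T).
Proof.
move=> cX Tc [xi wh] sA a Aa.
have [|z [cod _]] := coding_unique cX _ wh; first by exists a.
have tz : target_set T z by exists xi.
have Az := target_set_sub_attractor cX sA tz.
apply: closure_mdist => e e0.
have := strict_attractor_cvg1 sA Az; rewrite -(cvg_shiftS _).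
move=> /cvgrPdist_lt/(_ _ e0)/filter_ex[n].
rewrite sub0r normrN => /(le_lt_trans (ler_norm _)) /=; rewrite hausdorff_distC.
move=> /(hausdorff_dist_lt_near cX _ Aa)[|b bn ab].
  by exists (comp_seq T xi n z); exact: comp_seq_in_iter.
exists b => //; move: bn; apply: (@iter_barnsley_hutchinson_sub _ _ _ _ _ n.+1).
  exact: target_set_forward_invariant.
by move=> _ ->.
Qed.

Theorem proposition3p7 (R : realType) (X : metricType R) (k : nat)
    (T : 'I_k -> X -> X)
    (compactX : compact [set: X])
    (k_ge2 : (2 <= k)%N)
    (T_cont : forall i : 'I_k, continuous (T i))
    (St_nonempty : weakly_hyperbolic T !=set0) :
  (forall A B : set X, strict_attractor T A -> strict_attractor T B -> A = B) /\
  (forall A : set X, strict_attractor T A -> A = closure (target_set T)).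
Proof.
have attractorE A : strict_attractor T A -> A = closure (target_set T).
  move=> sA; apply/seteqP; split.
    exact: attractor_sub_closure_target_set.
  have clA : closed A.
    by case: sA => _ cA _; apply: compact_closed => //; exact: metric_hausdorff.
  rewrite [X in _ `<=` X](closure_id A).1//.
  by apply: closureS; exact: target_set_sub_attractor.
by split=> // A B /attractorE -> /attractorE.
Qed.
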